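(* Let $(X,\to,{}^*,1)$ be a quantum-Wajsberg algebra. The following are equivalent: (a) $X$ is $\vee$-commutative, i.e. $x\vee y=y\vee x$ for all $x,y\in X$; (b) $x\to y=(y\vee x)\to y$ and $x\le_Q x\vee y$, for all $x,y\in X$.
   Context: A BE algebra is an algebra $(X,\to,1)$ of type $(2,0)$ such that for all $x,y,z\in X$: $x\to x=1$; $x\to 1=1$; $1\to x=x$; $x\to(y\to z)=y\to(x\to z)$. Write $x\le y$ iff $x\to y=1$ (in general $\le$ is not a partial order). It is bounded if there is $0\in X$ with $0\le x$ for all $x$; then $x^*:=x\to 0$. A bounded BE algebra is involutive if $x^{**}=x$ for all $x$; it is then written $(X,\to,{}^*,1)$, with $0=1^*$. In an involutive BE algebra put $x\vee y:=(x\to y)\to y$, $x\wedge y:=(x^*\vee y^* )^*=((x^*\to y^* )\to y^* )^*$, and $x\le_Q y$ iff $x=x\wedge y$. A quantum-Wajsberg algebra is an involutive BE algebra satisfying $x\to ((x\wedge y)\wedge (z\wedge x))=(x\to y)\wedge (x\to z)$ for all $x,y,z\in X$. *)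

(* Defs.v *)
Declare Scope qw_scope.
Delimit Scope qw_scope with qw.
Open Scope qw_scope.

Reserved Notation "x ~> y" (at level 60, right associativity).
Reserved Notation "x \vee y" (at level 50, left associativity).
Reserved Notation "x \wedge y" (at level 50, left associativity).
Reserved Notation "x <=Q y" (at level 70, no associativity).

Record be_algebra := BEAlgebra {
  be_carrier :> Type;
  imp : be_carrier -> be_carrier -> be_carrier;
  one : be_carrier;
  imp_refl : forall x, imp x x = one;
  imp_one : forall x, imp x one = one;
  one_imp : forall x, imp one x = x;
  imp_exchange : forall x y z, imp x (imp y z) = imp y (imp x z)
}.

Arguments imp {b} x y : rename.
Arguments one {b} : rename.
Arguments imp_refl {b} x : rename.
Arguments imp_one {b} x : rename.
Arguments one_imp {b} x : rename.
Arguments imp_exchange {b} x y z : rename.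

Notation "x ~> y" := (imp x y) : qw_scope.

Definition be_le {X : be_algebra} (x y : X) : Prop := x ~> y = one.

(* [be_le] need not be antisymmetric, so a least element is not determined by
   the order: it is part of the structure. *)
Record bounded_be_algebra := BoundedBEAlgebra {
  bounded_be :> be_algebra;
  zero : bounded_be;
  zero_le : forall x : bounded_be, be_le zero x
}.

Arguments zero {b} : rename.
Arguments zero_le {b} x : rename.

Definition star {X : bounded_be_algebra} (x : X) : X := x ~> zero.

Lemma star_one (X : bounded_be_algebra) : star (one : X) = zero.
Proof. exact (one_imp zero). Qed.

Record involutive_be_algebra := InvolutiveBEAlgebra {
  involutive_be :> bounded_be_algebra;
  star_star : forall x : involutive_be, star (star x) = x
}.

Arguments star_star {i} x : rename.

Definition vee {X : involutive_be_algebra} (x y : X) : X := (x ~> y) ~> y.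
Notation "x \vee y" := (vee x y) : qw_scope.

Definition wedge {X : involutive_be_algebra} (x y : X) : X :=
  star (star x \vee star y).
Notation "x \wedge y" := (wedge x y) : qw_scope.

Definition leQ {X : involutive_be_algebra} (x y : X) : Prop := x = x \wedge y.
Notation "x <=Q y" := (leQ x y) : qw_scope.

Record quantum_wajsberg_algebra := QuantumWajsbergAlgebra {
  qw_involutive :> involutive_be_algebra;
  qw_axiom : forall x y z : qw_involutive,
    x ~> ((x \wedge y) \wedge (z \wedge x)) = (x ~> y) \wedge (x ~> z)
}.

Arguments qw_axiom {q} x y z : rename.

Definition vee_commutative (X : involutive_be_algebra) : Prop :=
  forall x y : X, x \vee y = y \vee x.

(* Main.v *)
Require Import Defs.

(** (b) makes [x \vee y = (y \vee x) \vee y], and [y <=Q y \vee x]; in a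
    quantum-Wajsberg algebra [y <=Q z] forces [z \vee y = z], so
    [x \vee y = y \vee x].  That [y <=Q z] forces [z \vee y = z] comes from the
    instance [z* = z* \wedge (z ~> y)] of the axiom.  The direction from (a)
    holds in every involutive BE algebra. *)

Section Involutive.
Context {X : involutive_be_algebra}.
Implicit Types x y z : X.

Lemma imp_star_comm x y : x ~> star y = y ~> star x.
Proof. unfold star; apply imp_exchange. Qed.

Lemma imp_star_star x y : star x ~> star y = y ~> x.
Proof. now rewrite imp_star_comm, star_star. Qed.

Lemma star_zero : star (zero : X) = one.
Proof. apply imp_refl. Qed.

Lemma star_wedge x y : star (x \wedge y) = (y ~> x) ~> star y.
Proof. unfold wedge, vee; now rewrite star_star, imp_star_star. Qed.

Lemma wedge_zero_r x : x \wedge zero = zero.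
Proof.
  now rewrite <- (star_star (x \wedge zero)), star_wedge, star_zero, imp_one,
    star_one.
Qed.

Lemma wedge_zero_l x : zero \wedge x = zero.
Proof.
  rewrite <- (star_star (zero \wedge x)), star_wedge.
  change (x ~> zero) with (star x).
  now rewrite imp_refl, star_one.
Qed.

Lemma be_le_vee_l x y : x ~> (x \vee y) = one.
Proof. unfold vee; rewrite imp_exchange; apply imp_refl. Qed.

(** Both halves of (b) come from this absorption: once commuted, the join is [one ~> z]. *)
Lemma vee_comm_absorb x z : vee_commutative X -> x ~> z = one -> z \vee x = z.
Proof.
  intros comm le; rewrite comm; unfold vee; rewrite le; apply one_imp.
Qed.

(** [star] reverses the order, so absorption applies to [star z] below [star x]. *)
Lemma vee_comm_leQ x z : vee_commutative X -> x ~> z = one -> x <=Q z.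
Proof.
  intros comm le; unfold leQ, wedge.
  now rewrite (vee_comm_absorb (star z) (star x)), star_star
    by (assumption || now rewrite imp_star_star).
Qed.

Lemma vee_comm_imp x y : vee_commutative X -> x ~> y = (y \vee x) ~> y.
Proof.
  intros comm; rewrite (comm y x).
  (* Both terms unfold to [((x ~> y) ~> y) ~> y]; absorption then only needs [y] below [x ~> y]. *)
  change ((x \vee y) ~> y) with ((x ~> y) \vee y).
  symmetry; apply vee_comm_absorb; [exact comm |].
  now rewrite imp_exchange, imp_refl, imp_one.
Qed.

End Involutive.

Lemma star_leQ_imp (X : quantum_wajsberg_algebra) (x y : X) :
  star x <=Q (x ~> y).
Proof.
  (* With [zero] in second place both inner meets collapse, leaving [x ~> zero] on the left. *)
  assert (ax := qw_axiom x zero y).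
  rewrite wedge_zero_r, wedge_zero_l in ax.
  exact ax.
Qed.

Lemma leQ_vee (X : quantum_wajsberg_algebra) (y z : X) :
  y <=Q z -> z \vee y = z.
Proof.
  intros le.
  assert (Hy : star y = (z ~> y) ~> star z).
  { now rewrite <- star_wedge, <- le. }
  (* By [Hy], the star of the right side becomes [star y ~> star (z ~> y)], which is [z \vee y] by
     contraposition. *)
  assert (Hz := f_equal star (star_leQ_imp X z y)).
  rewrite star_star, star_wedge, <- Hy, imp_star_star in Hz.
  now symmetry.
Qed.

Theorem theorem4p6 (X : quantum_wajsberg_algebra) :
  vee_commutative X <->
  (forall x y : X, x ~> y = (y \vee x) ~> y /\ x <=Q (x \vee y)).
Proof.
  split.
  - intros comm x y; split.
    + now apply vee_comm_imp.
    + apply vee_comm_leQ; [exact comm | apply be_le_vee_l].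
  - intros H x y.
    transitivity ((y \vee x) \vee y).
    + unfold vee at 1 2; now rewrite <- (proj1 (H x y)).
    + apply leQ_vee, H.
Qed.
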